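(* Let $n,r\in\mathbb N$ with $n\geq r$ and $r$ dividing $n$. Let $G$ be a $K_{r+1}$-free graph on $n$ vertices whose degree sequence $d_1\leq\dots\leq d_n$ satisfies $d_{n/r}\geq (r-1)n/r$. Then $G$ is a subgraph of $T(n,r)$ (i.e. $G$ is isomorphic to a subgraph of $T(n,r)$ on the same number of vertices).
   Context: $T(n,r)$ denotes the Turán graph: the complete $r$-partite graph on $n$ vertices in which each vertex class has size $\lfloor n/r\rfloor$ or $\lceil n/r\rceil$. The degree sequence $d_1\le\dots\le d_n$ lists the vertex degrees of $G$ in non-decreasing order. *)

(* Defs.v *)
From mathcomp Require Import all_boot.

Set Implicit Arguments.
Unset Strict Implicit.
Unset Printing Implicit Defensive.

Record sgraph := SGraph {
  vertex :> finType;
  adj : rel vertex;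
  adj_sym : symmetric adj;
  adj_irr : irreflexive adj
}.

(* H is isomorphic to a (not necessarily induced) subgraph of G. *)
Definition subgraph_of (H G : sgraph) : Prop :=
  exists f : H -> G, injective f /\ forall x y, adj x y -> adj (f x) (f y).

Section Complete.
Variable n : nat.
Let e : rel 'I_n := fun x y => x != y.
Fact complete_sym : symmetric e. Proof. by move=> x y; rewrite /e eq_sym. Qed.
Fact complete_irr : irreflexive e. Proof. by move=> x; rewrite /e eqxx. Qed.
Definition complete : sgraph := SGraph complete_sym complete_irr.
End Complete.

(* The vertex classes of the Turan graph on {0,...,n-1} are taken to be the
   residue classes modulo r; card_turan_class checks that they are balanced. *)
Section Turan.
Variables n r : nat.
Let e : rel 'I_n := fun x y => x %% r != y %% r.
Fact turan_sym : symmetric e. Proof. by move=> x y; rewrite /e eq_sym. Qed.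
Fact turan_irr : irreflexive e. Proof. by move=> x; rewrite /e eqxx. Qed.
Definition turan : sgraph := SGraph turan_sym turan_irr.
End Turan.

Lemma card_turan_class n r k : k < r ->
  #|[set x : turan n r | val x %% r == k]| = n %/ r + (k < n %% r).
Proof.
move=> kr; have r0 : 0 < r by case: r kr.
rewrite -sum1_card (eq_bigl (fun x : 'I_n => x %% r == k)); last first.
  by move=> x; rewrite inE.
rewrite big_mkcond /=.
elim: n => [|n IH]; first by rewrite big_ord0 div0n mod0n.
rewrite big_ord_recr /= {}IH divnS // modnS.
case: (boolP (r %| n.+1)) => [dv|ndv] /=.
  have E : n %% r = r.-1.
    apply/eqP; move: dv; rewrite /dvdn -addn1 -modnDml addn1.
    have := ltn_pmod n r0; rewrite leq_eqVlt => /orP[/eqP E _|Hlt].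
      by move/(congr1 predn): E => /= ->.
    by rewrite (modn_small Hlt).
  rewrite E addn0 add1n -[RHS]addn1 -addnA; congr (_ + _).
  have : k <= r.-1 by rewrite -ltnS (prednK r0).
  by case: ltngtP.
rewrite add0n -addnA ltnS; congr (_ + _).
by case: ltngtP.
Qed.

Definition deg (G : sgraph) (v : G) : nat := #|[set w | adj v w]|.

Definition degree_seq (G : sgraph) : seq nat := sort leq [seq deg v | v : G].

(* The i-th smallest degree d_i, indexed from 1: meaningful for 1 <= i <= #|G|. *)
Definition d_ (G : sgraph) (i : nat) : nat := nth 0 (degree_seq G) i.-1.

(* Main.v *)
Require Import Defs.
From mathcomp Require Import all_boot.
From mathcomp Require Import zify.

(** Put [m = n / r] and call a vertex big when its degree is at least
    [(r - 1) m], i.e. when it has at most [m] non-neighbours (itself included).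
    Fewer than [m] vertices are not big, while [k < r] big vertices have at
    least [(r - k) m >= m] common neighbours; hence a greedy choice yields an
    [r]-clique [x_1, ..., x_r] of big vertices.  As there is no
    [(r+1)]-clique, the [r] non-neighbourhoods [M_i] of the [x_i] cover the
    [r m] vertices, and having size at most [m] they are pairwise disjoint of
    size exactly [m].  An edge [y z] inside [M_i] would give the
    [(r+1)]-clique formed by [y], [z] and the [x_j] with [j <> i].  So the
    [M_i] are independent and are the classes of the desired embedding. *)

Set Implicit Arguments.
Unset Strict Implicit.
Unset Printing Implicit Defensive.

Lemma count_ltn_sorted (s : seq nat) (D i : nat) :
  sorted leq s -> D <= nth 0 s i -> count (fun d => d < D) s <= i.
Proof.
move=> s_sorted Di; rewrite -(cat_take_drop i s) count_cat.
have -> : count (fun d => d < D) (drop i s) = 0.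
  apply/eqP; rewrite -leqn0 leqNgt -has_count; apply/hasPn => d.
  move=> /(nthP 0)[j]; rewrite size_drop nth_drop => ltj <-.
  rewrite -leqNgt; apply: (leq_trans Di).
  have ltij : i + j < size s by rewrite -ltn_subRL.
  apply: (sorted_leq_nth leq_trans leqnn) => //; last exact: leq_addr.
  by rewrite inE (leq_ltn_trans (leq_addr j i)).
by rewrite addn0 (leq_trans (count_size _ _)) // size_take_min geq_minl.
Qed.

(** The bound is [i.-1] because [d_] counts from 1, so the degree in question sits at index [i.-1]
    of the sorted list. *)
Lemma card_deg_lt (G : sgraph) (D i : nat) :
  D <= d_ G i -> #|[set v : G | deg v < D]| <= i.-1.
Proof.
move=> Di; rewrite cardsE cardE /enum_mem size_filter -enumT.
rewrite (eq_count (a2 := preim (@deg G) (fun d => d < D))); last by [].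
rewrite -count_map; set s := map _ _.
have /permP <- : perm_eq (degree_seq G) s by rewrite perm_sort.
by apply: count_ltn_sorted => //; apply: sort_sorted leq_total _.
Qed.

(** Cliques are built below as pairwise adjacent sequences; this brings them into the form forbidden
    by [Kfree]. Injectivity comes from irreflexivity of [adj]. *)
Lemma clique_subgraph (G : sgraph) (s : seq G) :
  pairwise (@adj G) s -> subgraph_of (complete (size s)) G.
Proof.
move=> cl.
have nth_adj (x0 : G) i j : i < size s -> j < size s -> i != j ->
    adj (nth x0 s i) (nth x0 s j).
  move=> lti ltj; rewrite neq_ltn => /orP[] lt.
    by move/(pairwiseP x0): cl; apply.
  by rewrite adj_sym; move/(pairwiseP x0): cl; apply.
case: s cl nth_adj => [|x0 s] cl nth_adj.
  by exists (fun i : 'I_0 => False_rect _ (notF (ltn_ord i))); split=> -[].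
exists (fun i : 'I_(size (x0 :: s)) => nth x0 (x0 :: s) i).
split=> [i j eq_ij|i j].
  apply/eqP/negPn/negP => neq_ij.
  by have := nth_adj x0 i j (ltn_ord i) (ltn_ord j) neq_ij; rewrite eq_ij adj_irr.
exact: nth_adj x0 i j (ltn_ord i) (ltn_ord j).
Qed.

Lemma clique_uniq (G : sgraph) (s : seq G) : pairwise (@adj G) s -> uniq s.
Proof.
rewrite uniq_pairwise; apply: sub_pairwise => x y /= xy.
by apply: contraTneq xy => ->; rewrite adj_irr.
Qed.

Definition nonnbr (G : sgraph) (x : G) : {set G} := [set w | ~~ adj x w].

Lemma card_nonnbr (G : sgraph) (x : G) : #|nonnbr x| + deg x = #|G|.
Proof.
rewrite /deg -(cardsC [set w | adj x w]) addnC; congr (_ + _).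
by apply: eq_card => w; rewrite !inE.
Qed.

Lemma card_bigcup_nonnbr (G : sgraph) (m : nat) (s : seq G) :
  all (fun x => #|nonnbr x| <= m) s ->
  #|[set w | has (fun x => ~~ adj x w) s]| <= size s * m.
Proof.
elim: s => [|x s IH] /=.
  by move=> _; rewrite leqn0 cards_eq0; apply/eqP/setP => w; rewrite !inE.
move=> /andP[xm /IH le]; rewrite mulSn; apply: leq_trans (leq_add xm le).
apply: leq_trans (leq_card_setU _ _); apply: subset_leq_card.
by apply/subsetP=> w; rewrite !inE.
Qed.

Lemma big_clique (G : sgraph) (r m : nat) :
  #|G| = r * m -> #|[set x : G | m < #|nonnbr x|]| < m ->
  forall k, k <= r -> exists s : seq G,
    [/\ size s = k, pairwise (@adj G) s & all (fun x => #|nonnbr x| <= m) s].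
Proof.
move=> cardG small; elim=> [|k IH] kr; first by exists [::].
have [s [sz cl big]] := IH (ltnW kr).
(* [A] holds the vertices that cannot extend [s]: fewer than [k * m + m <= r * m] of them, so some
   vertex lies outside. *)
pose A := [set w | has (fun x => ~~ adj x w) s] :|: [set x : G | m < #|nonnbr x|].
have /subsetPn[w _] : ~~ ([set: G] \subset A).
  apply/negP => /subset_leq_card; rewrite cardsT cardG leqNgt => /negP; apply.
  apply: leq_ltn_trans (leq_card_setU _ _) _.
  have := card_bigcup_nonnbr big; rewrite sz => le.
  have : k.+1 * m <= r * m by rewrite leq_mul2r kr orbT.
  by rewrite mulSn; lia.
rewrite !inE negb_or -leqNgt => /andP[/hasPn ws wbig].
exists (w :: s); split=> /=; rewrite ?sz ?wbig ?cl ?andbT //.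
by apply/allP => x /ws; rewrite negbK adj_sym.
Qed.

Lemma card_fibers_eq (T : finType) (r m : nat) (c : T -> nat) :
  #|T| = r * m -> (forall v, c v < r) ->
  (forall i, i < r -> #|[set v | c v == i]| <= m) ->
  forall i, i < r -> #|[set v | c v == i]| = m.
Proof.
move=> cardT cr le i ir.
have sumE : \sum_(j < r) #|[set v | c v == j]| = \sum_(j < r) m.
  rewrite sum_nat_const card_ord -cardT -sum1_card.
  rewrite (partition_big (fun v => Ordinal (cr v)) predT) //=.
  by apply: eq_bigr => j _; rewrite -sum1_card; apply: eq_bigl => v; rewrite inE.
(* Each fibre has size at most [m] and the sums agree, so the equality case of the summed bound
   holds termwise. *)
have leif (j : 'I_r) (_ : true) := leqif_eq (le j (ltn_ord j)).
have := leqif_sum leif => -[_]; rewrite sumE eqxx => /esym/forallP/(_ (Ordinal ir)).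
by move/eqP.
Qed.

(** A vertex is sent to the number with remainder its colour and quotient its rank in the colour
    class, so colours become residues modulo [r]. *)
Lemma balanced_coloring_turan (G : sgraph) (r m : nat) (c : G -> nat) :
  (forall v, c v < r) -> (forall i, i < r -> #|[set v | c v == i]| = m) ->
  (forall y z, adj y z -> c y != c z) -> subgraph_of G (turan (r * m) r).
Proof.
move=> cr card_c proper.
pose idx v := index v (enum [set w | c w == c v]).
have idx_lt v : idx v < m.
  by rewrite -(card_c _ (cr v)) cardE index_mem mem_enum inE.
have val_lt v : idx v * r + c v < r * m.
  have : (idx v).+1 * r <= m * r by rewrite leq_mul2r idx_lt orbT.
  by rewrite mulSn [r * m]mulnC; have := cr v; lia.
have val_mod v : (idx v * r + c v) %% r = c v by rewrite modnMDl modn_small.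
exists (fun v => Ordinal (val_lt v) : turan (r * m) r); split => [u v|u v /proper].
  move=> /(congr1 val) /= eq_uv.
  have eq_c : c u = c v by rewrite -(val_mod u) eq_uv val_mod.
  have r_gt0 : 0 < r by apply: leq_ltn_trans (cr u).
  move/eqP: eq_uv; rewrite eq_c eqn_add2r eqn_pmul2r // /idx eq_c => /eqP.
  set t := enum _ => eq_idx; rewrite -(nth_index u (s := t) (x := u)); last first.
    by rewrite mem_enum inE eq_c.
  by rewrite eq_idx nth_index // mem_enum inE.
by rewrite /= !val_mod.
Qed.

Lemma few_large_nonnbr_turan (G : sgraph) (r m : nat) :
  #|G| = r * m -> ~ subgraph_of (complete r.+1) G ->
  #|[set x : G | m < #|nonnbr x|]| < m -> subgraph_of G (turan (r * m) r).
Proof.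
move=> cardG Kfree small.
have [s [sz cl big]] := big_clique cardG small (leqnn r).
pose c (v : G) := find (fun x => ~~ adj x v) s.
have cr v : c v < r.
  rewrite -sz -has_find; apply/negPn/negP => /hasPn nbr; apply: Kfree.
  rewrite -sz -/(size (v :: s)); apply: clique_subgraph; rewrite /= cl andbT.
  by apply/allP => x /nbr; rewrite negbK adj_sym.
have sub_c (x0 : G) i : [set v | c v == i] \subset nonnbr (nth x0 s i).
  apply/subsetP => v; rewrite !inE => /eqP <-.
  by apply: (nth_find x0 (a := fun x => ~~ adj x v)); rewrite has_find sz cr.
have nonnbr_le (x0 : G) i : i < r -> #|nonnbr (nth x0 s i)| <= m.
  by rewrite -sz => /(mem_nth x0); move/allP: big; apply.
have card_c : forall i, i < r -> #|[set v | c v == i]| = m.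
  apply: card_fibers_eq => // i ir.
  (* A vertex is needed only as the default of [nth]; without one the fibres are empty. *)
  case: (pickP G) => [x0 _|G0].
    exact: leq_trans (subset_leq_card (sub_c x0 i)) (nonnbr_le x0 i ir).
  by rewrite eq_card0 // => v; have := G0 v.
(* The fibres of [c] are the full non-neighbourhoods, although [c] only records
   the first non-neighbour: this is where the disjointness of the [M_i] sits. *)
have adj_c x v : x \in s -> index x s != c v -> adj x v.
  move=> xs; apply: contraR => nadj.
  have ir : index x s < r by rewrite -sz index_mem.
  have /eqP E : [set v | c v == index x s] == nonnbr x.
    have := sub_c x (index x s); have := nonnbr_le x _ ir.
    by rewrite nth_index // eqEcard card_c // => -> ->.
  have : v \in nonnbr x by rewrite inE.
  by rewrite -E inE eq_sym.
apply: (balanced_coloring_turan cr card_c) => y z yz.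
apply/eqP => eq_c; apply: Kfree.
(* [x] is the member of [s] to be exchanged for [y] and [z]: by [adj_c], both are adjacent to all
   the other members. *)
set x := nth y s (c y).
have xs : x \in s by rewrite mem_nth // sz.
have us := clique_uniq cl.
have rem_adj w v : w \in rem x s -> c v = c y -> adj v w.
  rewrite mem_rem_uniq // inE => /andP[neq ws] eq_v; rewrite adj_sym adj_c //.
  by rewrite eq_v; apply: contraNneq neq; rewrite /x => <-; rewrite nth_index.
have <- : size [:: y, z & rem x s] = r.+1.
  by rewrite /= size_rem // sz prednK // (leq_ltn_trans _ (cr y)).
apply: clique_subgraph; rewrite /= yz /=; apply/and3P; split.
- by apply/allP => w ws; apply: rem_adj.
- by apply/allP => w ws; apply: rem_adj.
- exact: subseq_pairwise (rem_subseq _ _) cl.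
Qed.

Theorem theorem1p10 (n r : nat) (r_gt0 : 0 < r) (le_rn : r <= n)
    (r_dvd_n : r %| n) (G : sgraph) (cardG : #|G| = n)
    (Kfree : ~ subgraph_of (complete r.+1) G)
    (hdeg : (r - 1) * n %/ r <= d_ G (n %/ r)) :
  subgraph_of G (turan n r).
Proof.
have m_gt0 : 0 < n %/ r by rewrite divn_gt0.
have nE : n = r * (n %/ r) by rewrite mulnC divnK.
move: hdeg; rewrite -muln_divA // => hdeg.
rewrite nE; apply: few_large_nonnbr_turan => //; first by rewrite -nE.
apply: leq_ltn_trans (_ : (n %/ r).-1 < n %/ r); last by rewrite prednK.
apply: leq_trans (card_deg_lt hdeg); apply: subset_leq_card.
(* Since [(r - 1) * (n %/ r) = n - n %/ r], more than [n %/ r] non-neighbours means a degree below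
   the threshold. *)
apply/subsetP => v; rewrite !inE mulnBl mul1n -nE.
by have := card_nonnbr v; rewrite cardG; lia.
Qed.
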